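(* There is an absolute constant $c>0$ such that for every integer $k\ge 1$ and every finite complete multidigraph $T$ whose arc set is the union of $k$ quasi-orders, $\gamma(T)\le c\cdot \ln(2k)\cdot k^{k+2}$; that is, $\gamma(T)=O(\ln(2k)\cdot k^{k+2})$.
   Context: A quasi-order on a set $S$ is a reflexive transitive relation, viewed as a digraph on $S$ with arcs $(x,y)$ for $x\le y$. A complete multidigraph is a directed graph in which multiple arcs and directed cycles of length two are allowed and in which between any two distinct vertices there is at least one arc. ''The arc set is the union of $k$ quasi-orders $P_1,\dots,P_k$'' means every arc $(x,y)$ of $T$ satisfies $x\le_i y$ for some $i$ and every pair $x\le_i y$ with $x\ne y$ is an arc of $T$. For a vertex $x$, $N^+(x)$ is $\{x\}$ together with all $y$ such that $(x,y)$ is an arc, and $N^+(S)=\bigcup_{x\in S}N^+(x)$. A set $S$ of vertices is dominating if $N^+(S)=V(T)$, and the domination number $\gamma(T)$ is the minimum size of a dominating set. *)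

(* Defs.v *)
From mathcomp Require Import all_boot.
Set Implicit Arguments.
Unset Strict Implicit.
Unset Printing Implicit Defensive.

(* Parallel arcs are distinct elements of [arc] with the same ends.  Loops are
   permitted: the arc (x, x) belongs to every quasi-order, and it does not
   affect domination. *)
Record multidigraph := Multidigraph {
  vertex : finType;
  arc : finType;
  tail : arc -> vertex;
  head : arc -> vertex
}.

Section Multidigraph.
Variable T : multidigraph.

Definition is_arc (x y : vertex T) : bool :=
  [exists a : arc T, (tail a == x) && (head a == y)].

Definition complete_multidigraph : Prop :=
  forall x y : vertex T, x != y -> is_arc x y || is_arc y x.

Definition out_nbhd (x : vertex T) : {set vertex T} :=
  x |: [set y | is_arc x y].

Definition out_nbhd_set (S : {set vertex T}) : {set vertex T} :=
  \bigcup_(x in S) out_nbhd x.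

Definition dominating (S : {set vertex T}) : bool :=
  out_nbhd_set S == [set: vertex T].

(* The full vertex set, used as the default of the minimum, is dominating by
   [dominatingT]. *)
Definition domination_number : nat :=
  #|[arg min_(S < [set: vertex T] | dominating S) #|S|]|.

Lemma dominatingT : dominating [set: vertex T].
Proof.
apply/eqP/setP=> x; rewrite in_setT; apply/bigcupP.
by exists x; rewrite ?in_setT // setU11.
Qed.

Lemma domination_numberP :
  (exists2 S, dominating S & #|S| = domination_number) /\
  (forall S, dominating S -> domination_number <= #|S|).
Proof.
rewrite /domination_number; case: arg_minnP => [|S domS minS].
  exact: dominatingT.
by split=> //; exists S.
Qed.

End Multidigraph.

Definition quasi_order (V : Type) (le : rel V) : Prop :=
  reflexive le /\ transitive le.

Definition union_of_quasi_orders (T : multidigraph) (k : nat) : Prop :=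
  exists P : 'I_k -> rel (vertex T),
    [/\ forall i, quasi_order (P i),
        forall a : arc T, exists i, P i (tail a) (head a)
      & forall i (x y : vertex T), P i x y -> x != y -> is_arc x y].

(* Main.v *)
Require Import Defs.
From mathcomp Require Import all_boot all_order all_algebra.
From mathcomp Require Import reals exp.
From mathcomp Require Import zify lra.
Set Implicit Arguments.
Unset Strict Implicit.
Unset Printing Implicit Defensive.
Import Order.TTheory GRing.Theory Num.Theory.
Local Open Scope ring_scope.

(** A complete digraph carries a finite sequence of vertices in which every
    vertex has at least a third of the terms as in-neighbours, hence at least
    the fraction [1 / 3k] of them in one of the [k] quasi-orders. Split the
    vertices according to this quasi-order, and split every class again, with
    a new sequence taken inside the class. After [k + 1] splittings some
    quasi-order [i] has been used twice, with sequences [t] and then [s].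
    Every term of [s] lies [i]-above a fraction [1 / 3k] of [t], so
    [O(k ln (2k))] terms of [t] lie [i]-below all but a smaller fraction of
    [s]; by transitivity they dominate every vertex of the class. There are
    [k ^ (k + 1)] classes. *)

(** * Averaging and greedy covering along sequences *)

Section DenseSequences.
Local Open Scope nat_scope.
Variable V : finType.
Implicit Types (A D : {set V}) (s t : seq V).

(** Any two vertices are related at least one way, so the [u]-weighted average of the out-weight is
    at least half the total. *)
Lemma total_heavy_out (r : rel V) (A : {set V}) (u : V -> nat) :
  total r -> A != set0 ->
  exists2 y, y \in A &
    \sum_(x in A) u x <= 2 * \sum_(x in A | r y x) u x.
Proof.
move=> r_tot /set0Pn[a aA]; set U := \sum_(x in A) u x.
pose out y := \sum_(x in A | r y x) u x.
have outE y : out y = \sum_(x in A) u x * r y x.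
  rewrite /out big_mkcondr; apply: eq_bigr => x _.
  by case: (r y x); rewrite ?muln1 ?muln0.
have double : U * U <= 2 * \sum_(y in A) u y * out y.
  rewrite mul2n -addnn.
  have -> : \sum_(y in A) u y * out y =
            \sum_(y in A) \sum_(x in A) u y * u x * r y x.
    by apply: eq_bigr => y _; rewrite outE big_distrr /=;
       apply: eq_bigr => x _; rewrite mulnA.
  rewrite {2}exchange_big /= -big_split /= big_distrl /=.
  apply: leq_sum => y _; rewrite big_distrr -big_split /=.
  apply: leq_sum => x _; rewrite (mulnC (u x)) -mulnDr.
  by apply: leq_pmulr; case/orP: (r_tot y x) => ->; rewrite ?addn1.
have [/existsP[y /andP[yA le_y]] | /existsPn light] :=
  boolP [exists y, (y \in A) && (U <= 2 * out y)]; first by exists y.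
have lt_out y : y \in A -> 2 * out y < U.
  by move=> yA; have := light y; rewrite yA -ltnNge.
have : \sum_(y in A) u y * (2 * out y).+1 <= U * U.
  by rewrite {1}/U big_distrl; apply: leq_sum => y yA;
     rewrite leq_mul2l lt_out ?orbT.
under eq_bigr => y _ do rewrite mulnS mulnCA.
rewrite big_split /= -big_distrr /= -/U.
(* The strict inequalities, weighted by [u], force [U = 0], yet [2 * out a < U]. *)
have := lt_out a aA; lia.
Qed.

(* Greedy doubling: each new element is chosen to cover half of the current
   total weight, and the weight of every vertex left uncovered is doubled. *)
Lemma greedy_weights (r : rel V) (A : {set V}) N :
  total r -> A != set0 ->
  exists s, [/\ size s = N, {subset s <= A} &
    2 ^ N * \sum_(x in A) 2 ^ count (fun y => ~~ r y x) s <= 3 ^ N * #|A|].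
Proof.
move=> r_tot A0; elim: N => [|N [s [sz_s sA IH]]].
  by exists [::]; split=> //=; rewrite expn0 !mul1n sum_nat_const muln1.
pose u x := 2 ^ count (fun y => ~~ r y x) s.
have [y yA heavy] := total_heavy_out u r_tot A0.
exists (y :: s); split=> /=; first by rewrite sz_s.
  by move=> z; rewrite inE => /predU1P[->|/sA].
have split_u : \sum_(x in A) u x =
    \sum_(x in A | r y x) u x + \sum_(x in A | ~~ r y x) u x by exact: bigID.
rewrite (bigID (r y)) /=.
under eq_bigr => x /andP[_ ->] do rewrite add0n -/(u x).
under [X in _ + X]eq_bigr => x /andP[_ ->] do rewrite add1n expnS -/(u x).
rewrite -big_distrr /= !expnS.
rewrite -/u in IH; move: split_u heavy IH.
set S1 := \sum_(x in A | r y x) _; set S2 := \sum_(x in A | ~~ _) _.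
set U := \sum_(x in A) _ => eU heavy IH.
have : 2 * (S1 + 2 * S2) <= 3 * U by lia.
by move=> /(leq_mul (leqnn (2 ^ N))); lia.
Qed.

(* The threshold 1/3 can be replaced by 1/2 (by linear programming duality);
   the greedy choice gives any constant below [log2 (4/3)]. *)
Lemma exists_dense_seq (r : rel V) (A : {set V}) :
  total r -> A != set0 ->
  exists s, [/\ 0 < size s, {subset s <= A} &
    forall x, x \in A -> size s <= 3 * count (r^~ x) s].
Proof.
(* A sparse [x] has weight at least [2 ^ (2 * M)], so [2 ^ (5 * M) <= 3 ^ (3 * M) * n]. As
   [(32 / 27) ^ 6 > 2], taking [M = 6 * n] contradicts [n < 2 ^ n]. *)
move=> r_tot A0; set n := #|A|; pose M := 6 * n.
have n_gt0 : 0 < n by rewrite card_gt0.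
have [s [sz_s sA]] := greedy_weights (3 * M) r_tot A0.
rewrite -/n => bound; exists s; split=> // [|x xA].
  by rewrite sz_s /M !muln_gt0.
rewrite leqNgt; apply/negP; rewrite sz_s => sparse.
have cnt : count (r^~ x) s + count (fun y => ~~ r y x) s = 3 * M.
  by rewrite -sz_s -(count_predC (r^~ x)).
have big2 : 2 ^ (2 * M) <= \sum_(x in A) 2 ^ count (fun y => ~~ r y x) s.
  rewrite (bigD1 x) //=; apply: leq_trans (leq_addr _ _).
  rewrite leq_exp2l //; lia.
have : 2 ^ (3 * M) * 2 ^ (2 * M) <= 3 ^ (3 * M) * n.
  by apply: leq_trans bound; rewrite leq_mul2l big2 orbT.
rewrite -expnD -mulnDl !expnM leqNgt => /negP[].
(* The two constants are generalized to keep them from being evaluated in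
   unary. *)
have base : 2 * (3 ^ 3) ^ 6 <= (2 ^ (3 + 2)) ^ 6 by lia.
have pos : 0 < (3 ^ 3) ^ 6 by lia.
move: ((3 ^ 3) ^ 6) ((2 ^ (3 + 2)) ^ 6) pos base => a b a_gt0 le_ab.
apply: (@leq_trans ((2 * a) ^ n)); last by rewrite leq_exp2r.
by rewrite expnMn mulnC ltn_pmul2r ?expn_gt0 ?a_gt0 // ltn_expl.
Qed.

(** Double counting of the pairs with [le z y], for [z] in [t] and [y] in [s]. *)
Lemma heavy_element (le : rel V) q t s :
  0 < size t -> (forall y, y \in s -> size t <= q * count (le^~ y) t) ->
  exists2 z, z \in t & size s <= q * count (le z) s.
Proof.
move=> t_gt0 dense.
have [/hasP[z zt hz]|/hasPn light] :=
  boolP (has (fun z => size s <= q * count (le z) s) t); first by exists z.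
have sumc l c : \sum_(z <- l : seq V) c = size l * c.
  by rewrite big_const_seq count_predT iter_addn_0 mulnC.
have dc : \sum_(z <- t) count (le z) s = \sum_(y <- s) count (le^~ y) t.
  under eq_bigr do rewrite -sum1_count big_mkcond.
  rewrite exchange_big; apply: eq_bigr => y _.
  by rewrite -sum1_count -big_mkcond.
have upper : \sum_(z <- t) (q * count (le z) s).+1 <= size t * size s.
  rewrite -sumc big_seq [leqRHS]big_seq.
  by apply: leq_sum => z zt; rewrite ltnNge light.
have lower : size s * size t <= \sum_(y <- s) q * count (le^~ y) t.
  rewrite -sumc big_seq [leqRHS]big_seq.
  by apply: leq_sum => z zt; rewrite dense.
move: upper lower; under eq_bigr do rewrite -addn1.
rewrite big_split /= sumc -!big_distrr /= dc; lia.
Qed.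

(** A heavy element for the still uncovered terms of [s] leaves at most a fraction [1 - 1 / q] of
    them uncovered. *)
Lemma greedy_cover (le : rel V) q t s m :
  0 < size t -> (forall y, y \in s -> size t <= q * count (le^~ y) t) ->
  exists D, #|D| <= m /\
    count (fun y => ~~ [exists z in D, le z y]) s * q ^ m
      <= q.-1 ^ m * size s.
Proof.
move=> t_gt0 dense; elim: m => [|m [D [szD IH]]].
  by exists set0; rewrite cards0 muln1 mul1n count_size.
pose unc D y := ~~ [exists z in D, le z y].
have [|z _ hz] := @heavy_element le q t (filter (unc D) s) t_gt0.
  by move=> y; rewrite mem_filter => /andP[_ /dense].
exists (z |: D); split.
  by rewrite (leq_trans (leq_card_setU _ _)) // cards1.
have eq_unc y : unc (z |: D) y = unc D y && ~~ le z y.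
  rewrite /unc -negb_or; congr (~~ _); apply/idP/orP.
    case/exists_inP => w; rewrite !inE => /predU1P[->|wD] lw; first by right.
    by left; apply/exists_inP; exists w.
  case=> [/exists_inP[w wD lw]|lz]; apply/exists_inP.
    by exists w; rewrite // !inE wD orbT.
  by exists z; rewrite ?setU11.
rewrite -/(unc _) (eq_count eq_unc).
have := count_predC (le z) (filter (unc D) s).
rewrite size_filter !count_filter in hz *.
have -> : count [predI predC (le z) & unc D] s =
          count (fun y => unc D y && ~~ le z y) s.
  by apply: eq_count => y /=; rewrite andbC.
move: hz IH; rewrite -/(unc D) !expnS.
set a := count _ s; set b := count _ s; set c := count _ s.
move=> hz IH eab.
have step : c * q <= q.-1 * a by case: q {dense IH} hz => [|q] /=; nia.
rewrite mulnA; apply: leq_trans (leq_mul step (leqnn (q ^ m))) _.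
by rewrite -!mulnA leq_mul2l IH orbT.
Qed.

(* Transitivity enters here: a few elements of [t] cover all but a fraction
   less than [1 / q] of [s], so some covered element of [s] lies below [x]. *)
Lemma dominate_doubly_dense (le : rel V) q m t s :
  transitive le -> q * q.-1 ^ m < q ^ m -> 0 < size t -> 0 < size s ->
  (forall y, y \in s -> size t <= q * count (le^~ y) t) ->
  exists D, #|D| <= m /\
    forall x, size s <= q * count (le^~ x) s -> exists2 z, z \in D & le z x.
Proof.
move=> le_tr hqm t_gt0 s_gt0 dense.
have [D [szD unc]] := greedy_cover m t_gt0 dense.
exists D; split=> // x hx.
pose cov y := [exists z in D, le z y].
have few : count (predC cov) s < count (le^~ x) s.
  rewrite -/(predC cov) in unc.
  have : count (predC cov) s * q * q ^ m < size s * q ^ m.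
    apply: leq_ltn_trans (_ : q * q.-1 ^ m * size s < _).
      by rewrite mulnAC mulnC -mulnA leq_mul2l unc orbT.
    by rewrite [ltnRHS]mulnC ltn_pmul2r.
  rewrite ltn_mul2r => /andP[_ lt1].
  by have := leq_trans lt1 hx; rewrite mulnC ltn_mul2l => /andP[].
have /hasP[y _ /andP[/exists_inP[z zD lzy] lyx]] :
    has (predI cov (le^~ x)) s.
  apply: contraLR few => /hasPn none; rewrite -leqNgt.
  rewrite -!sum1_count big_mkcond [leqRHS]big_mkcond /=.
  rewrite big_seq [leqRHS]big_seq; apply: leq_sum => y /none /=.
  by case: (cov y); case: (le y x).
by exists z; rewrite // (le_tr y).
Qed.

End DenseSequences.

(** * Colour classes of a union of quasi-orders *)

Section QuasiOrderUnion.
Local Open Scope nat_scope.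
Variables (V : finType) (k m : nat) (P : 'I_k -> rel V).
Hypothesis P_tr : forall i, transitive (P i).
Hypothesis P_total : total (fun x y => [exists i, P i x y]).
Hypothesis m_large : 3 * k * (3 * k).-1 ^ m < (3 * k) ^ m.

Let dense_below i (s : seq V) x := size s <= 3 * k * count ((P i)^~ x) s.

Lemma dense_color (s : seq V) x :
  size s <= 3 * count (fun y => [exists i, P i y x]) s ->
  exists i, dense_below i s x.
Proof.
move=> dense; apply/existsP/contraT => /existsPn sparse.
have union : count (fun y => [exists i, P i y x]) s <=
             \sum_(i < k) count ((P i)^~ x) s.
  elim: s {dense sparse} => [|y s IH] /=; first by rewrite big1.
  rewrite big_split /=; apply: leq_add IH.
  by case: existsP => // -[i Pi]; rewrite (bigD1 i) //= Pi.
have k_gt0 : 0 < k.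
  have := P_total x x; rewrite orbb => /existsP[i _].
  by apply: leq_ltn_trans (ltn_ord i).
have : \sum_(i < k) (3 * k * count ((P i)^~ x) s).+1 <= \sum_(i < k) size s.
  by apply: leq_sum => i _; rewrite ltnNge; exact: sparse.
under eq_bigr do rewrite -addn1.
rewrite big_split /= -big_distrr /= !sum_nat_const card_ord muln1.
have := leq_mul (leqnn k) (leq_trans dense (leq_mul (leqnn 3) union)).
rewrite mulnA (mulnC k 3) => ub /leq_trans/(_ ub).
by rewrite -[leqRHS]addn0 leq_add2l leqNgt k_gt0.
Qed.

(* [C] is the set of colours already used on the way down to [A]: for each of
   them some sequence is dense below every vertex of [A]. A class of [A] with a
   repeated colour is dominated by [m] vertices at once, so at most [k + 1]
   subdivisions are needed. *)
Lemma dominate_classes n (C : {set 'I_k}) (A : {set V}) :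
  #|~: C| < n ->
  (forall i, i \in C -> exists t : seq V, 0 < size t /\
     forall x, x \in A -> dense_below i t x) ->
  exists D : {set V}, #|D| <= k ^ n * m /\
    forall x, x \in A -> exists2 z, z \in D & [exists i, P i z x].
Proof.
(* The case [n = 0] is vacuous; at [n = 1] every colour is in [C], so no class is split further. *)
elim: n C A => // n IH C A cardC denseC.
have [->|A0] := eqVneq A set0.
  by exists set0; rewrite cards0; split=> // x; rewrite inE.
have [s [s_gt0 sA dense]] := exists_dense_seq P_total A0.
pose B i := [set x in A | dense_below i s x].
have domB i : exists D : {set V}, #|D| <= k ^ n * m /\
    forall x, x \in B i -> exists2 z, z \in D & [exists i, P i z x].
  have k_gt0 : 0 < k by apply: leq_ltn_trans (ltn_ord i).
  have [iC|iNC] := boolP (i \in C).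
    (* Repeated colour: [t] is dense below the terms of [s], which lie in [A], and [s] is dense
       below [B i]. *)
    have [t [t_gt0 tA]] := denseC i iC.
    have [|D [szD domD]] :=
      dominate_doubly_dense (P_tr (i:=i)) m_large t_gt0 s_gt0.
      by move=> y /sA/tA.
    exists D; split.
      by rewrite (leq_trans szD) // leq_pmull ?expn_gt0 ?k_gt0.
    move=> x; rewrite inE => /andP[_ /domD[z zD Pzx]].
    by exists z => //; apply/existsP; exists i.
  apply: (IH (i |: C)) => [|j].
    rewrite -ltnS (leq_trans _ cardC) // ltnS.
    apply: proper_card; rewrite properE setCS subsetUr /=.
    by apply/subsetPn; exists i; rewrite !inE ?eqxx.
  rewrite !inE => /predU1P[->|/denseC[t [t_gt0 tA]]].
    by exists s; split=> // x; rewrite inE => /andP[].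
  by exists t; split=> // x; rewrite inE => /andP[/tA].
have [D domD] := fin_all_exists domB.
exists (\bigcup_i D i); split.
  apply: (@leq_trans (\sum_(i < k) k ^ n * m)); last first.
    by rewrite sum_nat_const card_ord expnS mulnA.
  elim/big_ind2: _ => [|a A1 b B1 leA leB|i _]; first by rewrite cards0.
    by rewrite (leq_trans (leq_card_setU _ _)) // leq_add.
  by have [] := domD i.
move=> x xA; have [i dense_i] := dense_color (dense x xA).
have [_ /(_ x)] := domD i; rewrite inE xA => /(_ dense_i)[z zD Pzx].
by exists z => //; apply/bigcupP; exists i.
Qed.

Lemma dominate_union :
  exists D : {set V}, #|D| <= k ^ k.+1 * m /\
    forall x, exists2 z, z \in D & [exists i, P i z x].
Proof.
have [||D [szD domD]] := @dominate_classes k.+1 set0 setT.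
- by rewrite setC0 cardsT card_ord.
- by move=> i; rewrite inE.
by exists D; split=> // x; apply: domD; rewrite inE.
Qed.

End QuasiOrderUnion.

(** * Numerical estimates and the final bound *)

Lemma double_expn_pred q : (0 < q -> 2 * q.-1 ^ q <= q ^ q)%N.
Proof.
(* The binomial terms [q ^ q.+1] and [q.+1 * q ^ q] suffice. *)
case: q => [|q] // _; rewrite succnK -[X in (_ <= X ^ _)%N]addn1 expnDn.
rewrite !big_ord_recl /= bin0 bin1 !exp1n subn0 subn1 /= expnS; lia.
Qed.

(** Each block of [q] factors [1 - 1 / q] has product at most [1 / 2], so [L] blocks fall below
    [1 / q]. *)
Lemma sample_size q L : (0 < q -> q < 2 ^ L ->
  q * q.-1 ^ (q * L) < q ^ (q * L))%N.
Proof.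
move=> q_gt0 qL.
have [q1|q_gt1] := leqP q 1.
  have q1E : q = 1%N by lia.
  by rewrite q1E in qL *; case: L qL => [|L] //; rewrite !mul1n exp1n exp0n.
apply: (@leq_trans (2 ^ L * q.-1 ^ (q * L))%N).
  by rewrite ltn_pmul2r // expn_gt0; lia.
rewrite !expnM -expnMn; case: L {qL} => // L.
by rewrite leq_exp2r ?double_expn_pred.
Qed.

Lemma domination_number_le (T : multidigraph) k L :
  (0 < k)%N -> complete_multidigraph T -> union_of_quasi_orders T k ->
  (3 * k < 2 ^ L)%N -> (domination_number T <= 3 * L * k ^ (k + 2))%N.
Proof.
move=> k_gt0 complT [P [P_qo P_arc arc_P]] kL.
have arcP x y : is_arc x y -> [exists i, P i x y].
  case/existsP => a /andP[/eqP <- /eqP <-].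
  by have [i Pi] := P_arc a; apply/existsP; exists i.
have P_total : total (fun x y => [exists i, P i x y]).
  move=> x y; have [->|/complT/orP[]/arcP->] := eqVneq x y; rewrite ?orbT //.
  rewrite orbb; apply/existsP; exists (Ordinal k_gt0).
  by have [->] := P_qo (Ordinal k_gt0).
have [||D [szD domD]] :=
  dominate_union _ P_total (@sample_size (3 * k) L _ kL).
- by move=> i; have [] := P_qo i.
- by lia.
have [_ /(_ D)] := domination_numberP T; move=> /(_ _)/leq_trans; apply.
  apply/eqP/setP => x; rewrite in_setT; apply/bigcupP.
  have [z zD /existsP[i Pzx]] := domD x; exists z => //.
  rewrite !inE; have [//|neq_xz] := eqVneq x z.
  by rewrite (arc_P i) // eq_sym.
by rewrite (leq_trans szD) // addn2 (expnS _ k.+1); lia.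
Qed.

Theorem theorem1 (R : realType) :
  exists c : R, 0 < c /\
    forall (k : nat) (T : multidigraph),
      (1 <= k)%N -> complete_multidigraph T -> union_of_quasi_orders T k ->
      (domination_number T)%:R <= c * ln (2 * k%:R) * k%:R ^+ (k + 2).
Proof.
have ln2_gt0 : 0 < ln 2 :> R by rewrite ln_gt0 ?ltr1n.
(* With [L = l + 1], both [ln 2 <= ln (2k)] and [l * ln 2 <= ln (3k) <= 2 * ln (2k)] hold, the
   latter by [3k <= (2k)^2]. Hence [3 * L * ln 2 <= 9 * ln (2k)]. *)
exists (9 / ln 2); split=> [|k T k_gt0 complT unionT].
  by rewrite divr_gt0.
pose l := trunc_log 2 (3 * k).
have kl : (3 * k < 2 ^ l.+1)%N by rewrite trunc_log_ltn.
have := domination_number_le k_gt0 complT unionT kl.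
rewrite -(ler_nat R) => /le_trans; apply.
rewrite natrM natrX ler_wpM2r ?exprn_ge0 //.
rewrite natrM -(ler_pM2r ln2_gt0) [leRHS]mulrAC divfK ?gt_eqF //.
have -> : 2 * k%:R = (2 * k)%:R :> R by rewrite natrM.
have ln2k : ln 2 <= ln (2 * k)%:R :> R.
  by rewrite ler_ln ?posrE ?ltr0n ?ler_nat; lia.
have : l%:R * ln 2 <= 2 * ln (2 * k)%:R :> R.
  rewrite !mulr_natl -!lnXn ?ltr0n ?muln_gt0 ?k_gt0 // -!natrX.
  rewrite ler_ln ?posrE ?ltr0n ?ler_nat ?expn_gt0 ?muln_gt0 ?k_gt0 //.
  apply: (@leq_trans (3 * k)%N); first by apply: trunc_logP; lia.
  by nia.
rewrite -natr1; lra.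
Qed.
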